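(* For every nonnegative integer $n$, $$\sum_{\substack{i+j=n\\ i,j\ge0}} B_{2i}B_{2j}-\sum_{\substack{i+j=n\\ i\ge 0,\ j\ge1}} B_{2i+1}B_{2j-1}=\sum_{\substack{i+j=n\\ i,j\ge0}} C_{2i}B_{2j}.$$
   Context: For a nonnegative integer $m$, $C_m=\frac{1}{m+1}\binom{2m}{m}$ is the $m$th Catalan number and $B_m=\binom{2m}{m}$ is the $m$th central binomial coefficient. *)

(* Defs.v *)
From mathcomp Require Import all_boot all_order all_algebra.
Set Implicit Arguments.
Unset Strict Implicit.
Unset Printing Implicit Defensive.
Import GRing.Theory.
Local Open Scope ring_scope.

(* Both sequences are rational-valued, so that the division in [catalan] and
   the subtractions between their values are the genuine ones. *)
Definition central_bin (m : nat) : rat := 'C(2 * m, m)%:R.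

Definition catalan (m : nat) : rat := (m.+1)%:R^-1 * 'C(2 * m, m)%:R.

(* Main.v *)
(** Let [T m] be the sum of [B_a * B_b] over [a + b = m].  The relation
    [(k+1) B_(k+1) = (4k+2) B_k] together with the symmetry [a <-> b] gives
    [T (m+1) = 4 T m].  Since [2 C_m = 4 B_m - B_(m+1)], twice the right-hand
    side is [4 * sum B_2i B_2j - sum B_(2i+1) B_2j]; splitting [T (2n)] by parity
    and using that [sum B_(2i+1) B_2j] is half of [T (2n+1)], the claim becomes
    [T (2n+1) = 4 T (2n)]. *)
Require Import Defs.
From mathcomp Require Import all_boot all_order all_algebra.
From mathcomp Require Import ring lra zify.
Import GRing.Theory Num.Theory.
Local Open Scope ring_scope.

Lemma central_binS (k : nat) :
  k.+1%:R * central_bin k.+1 = (4 * k + 2)%:R * central_bin k.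
Proof.
rewrite /central_bin -!natrM; congr (_%:R).
(* Both identities pass through the intermediate coefficient ['C(2k+1, k)]. *)
have := mul_bin_diag (2 * k).+2 k; have := mul_bin_down (2 * k).+1 k.
rewrite (_ : 2 * k.+1 = (2 * k).+2)%N; last by lia.
rewrite (_ : (2 * k).+1 - k = k.+1)%N /=; last by lia.
nia.
Qed.

(** After multiplication by [m + 1], this is [4(m+1) - (4m+2) = 2]. *)
Lemma catalan_central_bin (m : nat) :
  2%:R * catalan m = 4%:R * central_bin m - central_bin m.+1.
Proof.
have m1 : m.+1%:R != 0 :> rat by rewrite pnatr_eq0.
apply: (mulfI m1).
rewrite mulrBr central_binS /catalan -/(central_bin m) natrD natrM -addn1 natrD.
by field; rewrite natr1.
Qed.

Definition central_bin_conv (m : nat) : rat :=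
  \sum_(i < m.+1) central_bin i * central_bin (m - i).

(** Adding the sum to its reversal replaces the weight [i] by [i + (m - i) = m]. *)
Lemma sum_id_central_bin (m : nat) :
  2%:R * (\sum_(i < m.+1) i%:R * (central_bin i * central_bin (m - i)))
  = m%:R * central_bin_conv m.
Proof.
rewrite mulr_natl mulr2n {2}(reindex_inj rev_ord_inj) -big_split mulr_sumr.
apply: eq_bigr => i _ /=.
have lein : (i <= m)%N by rewrite -ltnS.
by rewrite subSS subKn // natrB //; ring.
Qed.

Lemma central_bin_convS (m : nat) :
  central_bin_conv m.+1 = 4%:R * central_bin_conv m.
Proof.
have m1 : m.+1%:R != 0 :> rat by rewrite pnatr_eq0.
(* The factor [m + 1] becomes a weight [i] on the terms, which kills the term [i = 0] and lets
   [central_binS] lower the index in all others. *)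
apply: (mulfI m1); rewrite -sum_id_central_bin big_ord_recl mul0r add0r.
under eq_bigr => i _ do
  rewrite lift0 subSS mulrA central_binS natrD natrM mulrDl mulrDl -!mulrA.
rewrite big_split /= -!mulr_sumr -/(central_bin_conv m) -natr1.
have := sum_id_central_bin m.
set S := \sum_(i < _) _; lra.
Qed.

Lemma sum_double (F : nat -> rat) (n : nat) :
  \sum_(i < 2 * n) F i
  = \sum_(i < n) F (2 * i)%N + \sum_(i < n) F (2 * i + 1)%N.
Proof.
elim: n => [|n IHn]; first by rewrite !big_ord0 addr0.
rewrite (_ : 2 * n.+1 = (2 * n).+2)%N; last by lia.
by rewrite !big_ord_recr /= IHn addn1; ring.
Qed.

Lemma sum_antidiagonal (F : nat -> nat -> rat) (n : nat) :
  \sum_(i < n.+1) \sum_(j < n.+1 | (i + j == n)%N) F i j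
  = \sum_(i < n.+1) F i (n - i)%N.
Proof.
apply: eq_bigr => i _; rewrite (big_pred1 (rev_ord i)) /= ?subSS // => j.
rewrite inE -(inj_eq val_inj) /= subSS; have := ltn_ord i; lia.
Qed.

Lemma central_bin_conv_even (n : nat) :
  central_bin_conv (2 * n)
  = \sum_(i < n.+1) central_bin (2 * i) * central_bin (2 * (n - i))
    + \sum_(i < n) central_bin (2 * i + 1) * central_bin (2 * (n - i) - 1).
Proof.
(* The term of index [2n] is set aside so that the other [2n] terms pair up; it then closes the
   even-index sum. *)
rewrite /central_bin_conv big_ord_recr /=.
rewrite (sum_double (fun i => central_bin i * central_bin (2 * n - i))).
rewrite big_ord_recr /= !subnn addrAC.
congr (_ + _ + _); apply: eq_bigr => i _; congr (_ * central_bin _); lia.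
Qed.

(** Exactly one index of each product is odd, and reversal exchanges the two cases. *)
Lemma central_bin_conv_odd (n : nat) :
  central_bin_conv (2 * n).+1
  = 2%:R * \sum_(i < n.+1) central_bin (2 * i + 1) * central_bin (2 * (n - i)).
Proof.
rewrite /central_bin_conv (_ : (2 * n).+2 = 2 * n.+1)%N; last by lia.
rewrite (sum_double (fun i => central_bin i * central_bin ((2 * n).+1 - i))).
rewrite (reindex_inj rev_ord_inj) /= mulr_natl mulr2n.
congr (_ + _); apply: eq_bigr => i _; have := ltn_ord i => lt_i.
  by rewrite mulrC; congr (central_bin _ * central_bin _); lia.
by congr (_ * central_bin _); lia.
Qed.

Theorem theorem9 (n : nat) :
  (\sum_(i < n.+1) \sum_(j < n.+1 | (i + j == n)%N)
      central_bin (2 * i) * central_bin (2 * j))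
  - (\sum_(i < n.+1) \sum_(j < n.+1 | ((i + j == n) && (1 <= j))%N)
      central_bin (2 * i + 1) * central_bin (2 * j - 1))
  = \sum_(i < n.+1) \sum_(j < n.+1 | (i + j == n)%N)
      catalan (2 * i) * central_bin (2 * j).
Proof.
(* The constraint [1 <= j] moves into the summand, leaving a plain antidiagonal sum whose term
   [i = n] is zero. *)
under [X in _ - X]eq_bigr => i _ do rewrite big_mkcondr.
rewrite (sum_antidiagonal (fun i j => central_bin (2 * i) * central_bin (2 * j))).
rewrite (sum_antidiagonal (fun i j => catalan (2 * i) * central_bin (2 * j))).
rewrite (sum_antidiagonal (fun i j => if (1 <= j)%N then
  central_bin (2 * i + 1) * central_bin (2 * j - 1) else 0)).
rewrite [X in _ - X]big_ord_recr /= subnn addr0.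
under [X in _ - X]eq_bigr => i _ do rewrite subn_gt0 ltn_ord.
have RHS : 2%:R * (\sum_(i < n.+1) catalan (2 * i) * central_bin (2 * (n - i)))
  = 4%:R * (\sum_(i < n.+1) central_bin (2 * i) * central_bin (2 * (n - i)))
    - \sum_(i < n.+1) central_bin (2 * i + 1) * central_bin (2 * (n - i)).
  rewrite !mulr_sumr -sumrB; apply: eq_bigr => i _.
  by rewrite mulrA catalan_central_bin addn1; ring.
(* With [E], [O] the two sums on the left and [M] the mixed sum in [RHS], this reads
   [2M = 4(E + O)], hence [4E - M = 2(E - O)]. *)
have := central_bin_convS (2 * n).
rewrite central_bin_conv_odd central_bin_conv_even; lra.
Qed.
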